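(* Let $\mathcal{M}\subset\mathbb{R}^m$ satisfy: (A1) $\mathcal{M}\cong\mathcal{G}/\mathcal{H}$ is a connected compact homogeneous manifold smoothly embedded in $\mathbb{R}^m$ with constant Euclidean norm $\|y\|=r_{\mathcal{M}}$ for all $y\in\mathcal{M}$, and the Lie group $\mathcal{G}$ acts as a subgroup of the orthogonal group on $\mathbb{R}^m$; (A2) for any fixed $b\in\mathbb{R}^m$, the local maxima of $f(c)=c^Tb$ over $c\in\mathcal{M}$ are all global maxima. Let $G$ be an undirected weighted graph on $N$ vertices with adjacency matrix $A=[a_{jk}]$, and let $$P_L(y)=\frac{1}{2N^2}\sum_{k=1}^N\sum_{j=1}^N a_{jk}\,y_j^Ty_k,\qquad y=(y_1,\dots,y_N)\in\mathcal{M}^N .$$ Then any local maximum of $P_L$ on $\mathcal{M}^N$ is a consensus configuration for $G$, and any local minimum of $P_L$ on $\mathcal{M}^N$ is an anti-consensus configuration for $G$.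
   Context: The adjacency matrix satisfies $a_{jk}\ge0$, $a_{kk}=0$; undirected means $A=A^T$. A consensus configuration for $G$ is $(y_1,\dots,y_N)\in\mathcal{M}^N$ with $y_k\in\mathop{\mathrm{argmax}}_{c\in\mathcal{M}}\big(c^T\sum_{j}a_{jk}y_j\big)$ for all $k$; an anti-consensus configuration is one with $y_k\in\mathop{\mathrm{argmin}}_{c\in\mathcal{M}}\big(c^T\sum_{j}a_{jk}y_j\big)$ for all $k$ (global optimizers over $\mathcal{M}$). *)

(* Defs.v *)
(* R^m is the type ['cV[R]_m] of column vectors over [R : realType]. *)
From HB Require Import structures.
From mathcomp Require Import all_boot all_order all_algebra.
From mathcomp Require Import all_classical all_reals all_analysis.

Set Implicit Arguments.
Unset Strict Implicit.
Unset Printing Implicit Defensive.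

Import Order.TTheory GRing.Theory Num.Theory.
Import numFieldNormedType.Exports.

Local Open Scope classical_set_scope.
Local Open Scope ring_scope.

(* The topology carried by matrix types is that of the entrywise max norm,
   hence the usual one; the Euclidean norm is introduced separately. *)
Definition dotv (R : realType) (m : nat) (x y : 'cV[R]_m) : R :=
  (x^T *m y) 0 0.

Definition enorm (R : realType) (m : nat) (x : 'cV[R]_m) : R :=
  Num.sqrt (dotv x x).

(* f is C^k on U; meant for U open and V finite-dimensional, where existence
   of the differential with all directional derivatives C^(k-1) is
   equivalent to f being C^k. *)
Fixpoint Ck_on (R : realType) (V W : normedModType R) (k : nat)
    (U : set V) (f : V -> W) : Prop :=
  if k is k'.+1 then
    (forall x, U x -> differentiable f x) /\
    (forall v, Ck_on k' U (fun x => 'D_v f x))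
  else forall x, U x -> {for x, continuous f}.

Definition smooth_on (R : realType) (V W : normedModType R)
    (U : set V) (f : V -> W) : Prop :=
  forall k, Ck_on k U f.

(* M is a d-dimensional embedded submanifold of R^m: around each point a
   diffeomorphism f, with inverse h, between open sets of R^m straightens M
   to the slice on which the coordinates of index >= d vanish. *)
Definition embedded_submanifold (R : realType) (m d : nat)
    (M : set 'cV[R]_m) : Prop :=
  (d <= m)%N /\
  forall p, M p ->
  exists (U : set 'cV[R]_m) (f h : 'cV[R]_m -> 'cV[R]_m),
    [/\ open U /\ U p,
        open (f @` U),
        smooth_on U f /\ smooth_on (f @` U) h,
        (forall x, U x -> h (f x) = x) &
        (forall x, U x -> M x <-> forall i : 'I_m, (d <= i)%N -> f x i 0 = 0)].

Record chart (R : realType) (T : topologicalType) (n : nat) := Chart {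
  chart_dom : set T ;
  chart_map : T -> 'rV[R]_n ;
  chart_inv : 'rV[R]_n -> T }.

Definition chart_codom (R : realType) (T : topologicalType) (n : nat)
    (c : chart R T n) : set 'rV[R]_n := chart_map c @` chart_dom c.

Definition is_chart (R : realType) (T : topologicalType) (n : nat)
    (c : chart R T n) : Prop :=
  [/\ open (chart_dom c),
      open (chart_codom c),
      (forall x, chart_dom c x -> chart_inv c (chart_map c x) = x),
      (forall x, chart_dom c x -> {for x, continuous (chart_map c)}) &
      (forall u, chart_codom c u -> {for u, continuous (chart_inv c)})].

(* A smooth structure on T, given by a not necessarily maximal atlas. *)
Definition smooth_atlas (R : realType) (T : topologicalType) (n : nat)
    (atlas : set (chart R T n)) : Prop :=
  [/\ (forall c, atlas c -> is_chart c),
      (forall x, exists2 c, atlas c & chart_dom c x) &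
      (forall c c', atlas c -> atlas c' ->
        smooth_on (chart_map c @` (chart_dom c `&` chart_dom c'))
                  (chart_map c' \o chart_inv c))].

#[short(type="groupTopologicalType")]
HB.structure Definition GroupTopological := {G of Group G & Topological G}.

(* The group operations are required to be continuous so that the sets on
   which their coordinate expressions must be smooth are open. *)
Definition lie_group_axioms (R : realType) (G : groupTopologicalType)
    (n : nat) (atlas : set (chart R G n)) : Prop :=
  [/\ hausdorff_space G /\ @second_countable G,
      smooth_atlas atlas,
      continuous (fun p : G * G => (p.1 * p.2)%g) /\
      continuous (fun g : G => (g^-1)%g),
      (forall a b c, atlas a -> atlas b -> atlas c ->
        smooth_on
          [set p : 'rV[R]_n * 'rV[R]_n |
            [/\ chart_codom a p.1, chart_codom b p.2 &
                chart_dom c (chart_inv a p.1 * chart_inv b p.2)%g]]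
          (fun p => chart_map c (chart_inv a p.1 * chart_inv b p.2)%g)) &
      (forall a c, atlas a -> atlas c ->
        smooth_on
          [set u | chart_codom a u /\ chart_dom c (chart_inv a u)^-1%g]
          (fun u => chart_map c (chart_inv a u)^-1%g))].

Record lieGroup (R : realType) := LieGroup {
  lie_sort :> groupTopologicalType ;
  lie_dim : nat ;
  lie_atlas : set (chart R lie_sort lie_dim) ;
  lie_axioms : lie_group_axioms lie_atlas }.

(* A Lie group homomorphism G -> O(m); it need not be injective, e.g. -1 acts
   trivially by conjugation on orthogonal projectors. *)
Definition orthogonal_action (R : realType) (m : nat) (G : lieGroup R)
    (rho : G -> 'M[R]_m) : Prop :=
  [/\ rho 1%g = 1%:M,
      (forall g h : G, rho (g * h)%g = rho g *m rho h),
      (forall g, (rho g)^T *m rho g = 1%:M) &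
      (forall c, lie_atlas c -> smooth_on (chart_codom c) (rho \o chart_inv c))].

(* M is the homogeneous space G/H: G acts transitively on M with isotropy
   group H at a base point, so g H |-> rho g y0 is a bijection G/H -> M.  When
   M is an embedded submanifold this equivariant bijection is automatically a
   diffeomorphism (constant rank, G being second countable). *)
Definition homogeneous_space (R : realType) (m : nat) (G : lieGroup R)
    (rho : G -> 'M[R]_m) (H : set G) (M : set 'cV[R]_m) : Prop :=
  exists y0, M = range (fun g => rho g *m y0) /\
             H = [set g | rho g *m y0 = y0].

Definition assumption_A1 (R : realType) (m : nat) (G : lieGroup R)
    (rho : G -> 'M[R]_m) (H : set G) (r : R) (M : set 'cV[R]_m) : Prop :=
  [/\ connected M /\ compact M,
      (exists d, embedded_submanifold d M),
      (forall y, M y -> enorm y = r),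
      orthogonal_action rho &
      homogeneous_space rho H M].

(* Extrema of the restriction of f to S. *)
Definition local_max_on (R : realType) (T : topologicalType) (S : set T)
    (f : T -> R) (x : T) : Prop :=
  S x /\ \forall z \near x, S z -> f z <= f x.

Definition local_min_on (R : realType) (T : topologicalType) (S : set T)
    (f : T -> R) (x : T) : Prop :=
  S x /\ \forall z \near x, S z -> f x <= f z.

Definition argmax_on (R : realType) (T : Type) (S : set T) (f : T -> R) :
  set T := [set x | S x /\ forall z, S z -> f z <= f x].

Definition argmin_on (R : realType) (T : Type) (S : set T) (f : T -> R) :
  set T := [set x | S x /\ forall z, S z -> f x <= f z].

Definition assumption_A2 (R : realType) (m : nat) (M : set 'cV[R]_m) : Prop :=
  forall b : 'cV[R]_m,
    local_max_on M (fun c => dotv c b) `<=` argmax_on M (fun c => dotv c b).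

Definition undirected_adjacency (R : realType) (N : nat) (A : 'M[R]_N) :
    Prop :=
  [/\ (forall j k, 0 <= A j k), (forall k, A k k = 0) & A^T = A].

(* (R^m)^N with the product topology. *)
Definition swarm (R : realType) (m N : nat) : topologicalType :=
  prod_topology (fun _ : 'I_N => 'cV[R]_m).

Definition power (R : realType) (m N : nat) (M : set 'cV[R]_m) :
    set (swarm R m N) := [set y | forall k, M (y k)].

Definition P_L (R : realType) (m N : nat) (A : 'M[R]_N) (y : swarm R m N) : R :=
  (2 * N%:R ^+ 2)^-1 *
  \sum_(k < N) \sum_(j < N) A j k * dotv (y j) (y k).

Definition consensus (R : realType) (m N : nat) (M : set 'cV[R]_m)
    (A : 'M[R]_N) (y : swarm R m N) : Prop :=
  forall k, argmax_on M (fun c => dotv c (\sum_(j < N) A j k *: y j)) (y k).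

Definition anti_consensus (R : realType) (m N : nat) (M : set 'cV[R]_m)
    (A : 'M[R]_N) (y : swarm R m N) : Prop :=
  forall k, argmin_on M (fun c => dotv c (\sum_(j < N) A j k *: y j)) (y k).

(* Main.v *)
(* Since A is symmetric with zero diagonal, P_L is an affine function of each
   single y_k, with linear part c |-> N^-2 c^T sum_j a_jk y_j.  Hence moving
   y_k alone turns a local maximum of P_L into a local maximum of a linear
   function on M, which (A2) makes global.  Minima are maxima for -A. *)
Require Import Defs.
From mathcomp Require Import all_boot all_order all_algebra.
From mathcomp Require Import all_classical all_reals all_analysis.
From mathcomp Require Import ring.

Import Order.TTheory GRing.Theory Num.Theory.
Import numFieldNormedType.Exports.

Local Open Scope classical_set_scope.
Local Open Scope ring_scope.

Lemma dotvC (R : realType) (m : nat) (x y : 'cV[R]_m) : dotv x y = dotv y x.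
Proof. by rewrite /dotv !mxE; apply: eq_bigr => i _; rewrite !mxE mulrC. Qed.

Lemma dotvDl (R : realType) (m : nat) (x y z : 'cV[R]_m) :
  dotv (x + y) z = dotv x z + dotv y z.
Proof. by rewrite /dotv linearD mulmxDl mxE. Qed.

Lemma dotvDr (R : realType) (m : nat) (x y z : 'cV[R]_m) :
  dotv x (y + z) = dotv x y + dotv x z.
Proof. by rewrite dotvC dotvDl !(dotvC _ _ x). Qed.

Lemma dotvBl (R : realType) (m : nat) (x y z : 'cV[R]_m) :
  dotv (x - y) z = dotv x z - dotv y z.
Proof. by apply/eqP; rewrite eq_sym subr_eq -dotvDl subrK. Qed.

Lemma dotvNr (R : realType) (m : nat) (x y : 'cV[R]_m) :
  dotv x (- y) = - dotv x y.
Proof. by rewrite /dotv mulmxN mxE. Qed.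

Lemma dotvZl (R : realType) (m : nat) (a : R) (x y : 'cV[R]_m) :
  dotv (a *: x) y = a * dotv x y.
Proof. by rewrite /dotv linearZ /= -scalemxAl mxE. Qed.

Lemma dotvZr (R : realType) (m : nat) (a : R) (x y : 'cV[R]_m) :
  dotv x (a *: y) = a * dotv x y.
Proof. by rewrite dotvC dotvZl dotvC. Qed.

Lemma dotv_sumr (R : realType) (m : nat) (I : finType) (x : 'cV[R]_m)
    (F : I -> 'cV[R]_m) :
  dotv x (\sum_i F i) = \sum_i dotv x (F i).
Proof. by rewrite /dotv mulmx_sumr summxE. Qed.

(** Put [d = c - y k]. The term quadratic in [d] carries the factor [A k k = 0]. The linear terms
    from row [k] and column [k] agree by symmetry, and their sum cancels the 2 in the
    normalization. *)
Lemma P_L_dfwith (R : realType) (m N : nat) (A : 'M[R]_N) (y : swarm R m N)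
    (k : 'I_N) (c : 'cV[R]_m) :
    A^T = A -> A k k = 0 ->
  P_L A (dfwith y k c : swarm R m N) = P_L A y +
    (N%:R ^+ 2)^-1 * (dotv c (\sum_(j < N) A j k *: y j) -
                      dotv (y k) (\sum_(j < N) A j k *: y j)).
Proof.
move=> symA Akk; set z : swarm R m N := dfwith y k c.
(* Kept opaque, so that bilinear expansion does not split [d] back into [c] and [y k]. *)
have [d defd] : {d | d = c - y k} by exists (c - y k).
have AC i j : A i j = A j i by rewrite -{1}symA mxE.
(* The Kronecker factor lets [dotv (z j) (z i)] expand uniformly, with no case split on [i] and
   [j]. *)
have zE j : z j = y j + (j == k)%:R *: d.
  rewrite /z; have [->|jk] := eqVneq j k.
    by rewrite dfwithin defd scale1r addrC subrK.
  by rewrite dfwithout 1?eq_sym// scale0r addr0.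
have dE : dotv d (\sum_(j < N) A j k *: y j) =
          \sum_(j < N) A j k * dotv d (y j).
  by rewrite dotv_sumr; apply: eq_bigr => j _; rewrite dotvZr.
have termE i j : A j i * dotv (z j) (z i) = A j i * dotv (y j) (y i) +
    ((j == k)%:R * (A j i * dotv d (y i)) +
     (i == k)%:R * (A j i * dotv d (y j))).
  (* This is the coefficient of [dotv d d]; [ring] uses the equation to discard that term. *)
  have zero : (j == k)%:R * (i == k)%:R * A j i = 0.
    have [->|_] := eqVneq j k; last by rewrite !mul0r.
    by have [->|_] := eqVneq i k; rewrite ?Akk (mulr0, mul0r) // mul0r.
  rewrite !zE !(dotvDl, dotvDr, dotvZl, dotvZr) (dotvC _ _ (y j) d).
  by ring: zero.
have pick (F : 'I_N -> R) : \sum_(i < N) (i == k)%:R * F i = F k.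
  rewrite (bigD1 k) //= eqxx mul1r big1 ?addr0 // => i /negPf->.
  by rewrite mul0r.
rewrite -dotvBl -defd dE /P_L.
under eq_bigr => i _.
  under eq_bigr => j _ do rewrite termE.
  rewrite big_split big_split /= pick -mulr_sumr; over.
rewrite big_split big_split /= pick.
(* Symmetry turns the row sum into the column sum, leaving twice the same [S]. *)
under [X in _ + (X + _)]eq_bigr => i _ do rewrite AC.
rewrite mulrDr; congr (_ + _); rewrite invfM; set S := \sum_(i < N) _.
by rewrite -mulr2n -(mulr_natl S) -mulrA mulrCA mulKf ?pnatr_eq0.
Qed.

(** Stated for any symmetric [A] with zero diagonal, so that it applies to [- A] when minima are
    treated. *)
Lemma local_max_P_L_consensus (R : realType) (m N : nat) (M : set 'cV[R]_m)
    (A : 'M[R]_N) (y : swarm R m N) :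
    assumption_A2 M -> A^T = A -> (forall k, A k k = 0) ->
  local_max_on (power M) (P_L A) y -> consensus M A y.
Proof.
move=> A2 symA A0 [My nearP] k; apply: A2; split; first exact: My.
(* The index [k] witnesses that [N] is nonzero, so this is a genuine inverse and the sign of the
   increment is that of the linear form. *)
have N2_gt0 : 0 < (N%:R ^+ 2 : R)^-1.
  by rewrite invr_gt0 exprn_gt0// ltr0n (leq_ltn_trans _ (ltn_ord k)).
(* Inserting [c] at coordinate [k] is continuous into the product, so a neighbourhood of [y] pulls
   back to one of [y k]. *)
have dfwith_cvg : (dfwith y k c : swarm R m N) @[c --> y k] --> y.
  have {3}-> : y = dfwith y k (y k).
    by apply: functional_extensionality_dep => j; case: dfwithP.
  exact: (@dfwith_continuous _ (fun=> 'cV[R]_m : topologicalType)).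
have near_dfwith : \forall c \near y k,
    power M (dfwith y k c : swarm R m N) ->
    P_L A (dfwith y k c : swarm R m N) <= P_L A y.
  exact: dfwith_cvg nearP.
apply: filterS near_dfwith => c le_c Mc.
have /le_c : power M (dfwith y k c : swarm R m N) by move=> j; case: dfwithP.
by rewrite P_L_dfwith// gerDl pmulr_rle0// subr_le0.
Qed.

Lemma P_LN (R : realType) (m N : nat) (A : 'M[R]_N) (y : swarm R m N) :
  P_L (- A) y = - P_L A y.
Proof.
rewrite /P_L -mulrN -sumrN; congr (_ * _); apply: eq_bigr => k _.
by rewrite -sumrN; apply: eq_bigr => j _; rewrite mxE mulNr.
Qed.

Theorem proposition6 (R : realType) (m N : nat) (M : set 'cV[R]_m) (rM : R)
    (G : lieGroup R) (rho : G -> 'M[R]_m) (H : set G)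
    (hA1 : assumption_A1 rho H rM M) (hA2 : assumption_A2 M)
    (A : 'M[R]_N) (hA : undirected_adjacency A) :
  (forall y : swarm R m N,
     local_max_on (power M) (P_L A) y -> consensus M A y) /\
  (forall y : swarm R m N,
     local_min_on (power M) (P_L A) y -> anti_consensus M A y).
Proof.
have [_ A0 symA] := hA; split=> y; first exact: local_max_P_L_consensus.
move=> [My nearP] k.
have /(_ k)[Myk le_yk] : consensus M (- A) y.
  apply: local_max_P_L_consensus => //.
  - by rewrite linearN /= symA.
  - by move=> i; rewrite mxE A0 oppr0.
  - by split=> //; apply: filterS nearP => z /[apply]; rewrite !P_LN lerN2.
(* The linear form attached to [- A] is the opposite one, so its maximizers are the minimizers
   sought. *)
have NE : \sum_(j < N) (- A) j k *: y j = - \sum_(j < N) A j k *: y j.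
  by rewrite -sumrN; apply: eq_bigr => j _; rewrite mxE scaleNr.
by split=> // z /le_yk; rewrite NE !dotvNr lerN2.
Qed.
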